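(* Suppose the Tracking Assumption stated in the context holds. Then, for the sequence $\{\alpha^n\}_{n\in\mathbb N}$ generated by the algorithm described in the context, $\|\alpha^n-\widehat\alpha\|^2\to 0$ linearly.
   Context: Notation. $\mathbb L(X;Y)$ denotes bounded linear operators between Hilbert spaces; $B(x,r)$ is the closed ball. For self-adjoint positive semi-definite $Q$, $\|x\|_Q:=\sqrt{\langle Qx,x\rangle}$ and $B_Q(x,r)$ is the closed ball in $\|\cdot\|_Q$. For $p\in\mathbb L(U;\mathscr A)$ and positive definite $Q$, $\|p\|_{Q^{-1}}:=\|pQ^{-1/2}\|_{\mathbb L(U;\mathscr A)}$. Gradients are Riesz representations or Hilbert adjoints of Fréchet derivatives: $\nabla_\alpha S_u(\alpha):=S_u'(\alpha)^*\in\mathbb L(U;\mathscr A)$, $\nabla_uG(u;\alpha)\in\mathbb L(U;U)$ and $\nabla_\alpha G(u;\alpha)\in\mathbb L(U;\mathscr A)$ are the adjoints of the partial derivatives of $G$. $\operatorname{dom}R=\{R<\infty\}$, $\partial R$ is the convex subdifferential, $\operatorname{prox}_R(x):=\arg\min_z\frac12\|z-x\|^2+R(z)$. Setting. $U,\mathscr A$ are Hilbert spaces, $R:\mathscr A\to\mathbb R\cup\{\infty\}$ is convex, proper, lower semicontinuous, $J:U\to\mathbb R$ is convex and Fréchet differentiable, $G:U\times\mathscr A\to U$ is Fréchet differentiable. The point $(\widehat u,\widehat p,\widehat\alpha)\in U\times\mathbb L(U;\mathscr A)\times\mathscr A$ satisfies $G(\widehat u;\widehat\alpha)=0$, $\widehat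 p\,\nabla_uG(\widehat u;\widehat\alpha)+\nabla_\alpha G(\widehat u;\widehat\alpha)=0$, $0\in\widehat p\,\nabla_uJ(\widehat u)+\partial R(\widehat\alpha)$; with the solution map $S_u$ below, $\widehat u=S_u(\widehat\alpha)$ and $\widehat p=\nabla_\alpha S_u(\widehat\alpha)$. Algorithm. Given $\sigma>0$ and $(u^0,p^0,\alpha^0)\in U\times\mathbb L(U;\mathscr A)\times\operatorname{dom}R$, set $\alpha^{-1}:=\alpha^0$. For $k=0,1,2,\dots$: (a) find $u^{k+1}$ (by the inner algorithm, $u^{k+1}=A_u(u^k,\alpha^k)$) with $\kappa_u\|u^{k+1}-S_u(\alpha^k)\|_Q\le\|u^k-S_u(\alpha^{k-1})\|_Q+\pi_u\|\alpha^k-\alpha^{k-1}\|$; (b) find $p^{k+1}$ (by the adjoint algorithm, $p^{k+1}=A_p(u^{k+1},p^k,\alpha^k)$) with $\kappa_p\|p^{k+1}-\nabla_\alpha S_u(\alpha^k)\|_{Q^{-1}}\le\|p^k-\nabla_\alpha S_u(\alpha^{k-1})\|_{Q^{-1}}+C_S\|u^{k+1}-S_u(\alpha^k)\|_Q+\pi_p\|\alpha^k-\alpha^{k-1}\|$ (both inequalities whenever $\alpha^k,\alpha^{k-1}$ lie in the domain $\mathscr A_{2r}$ of $S_u$ below); (c) $\alpha^{k+1}:=\operatorname{prox}_{\sigma R}(\alpha^k-\sigma p^{k+1}\nabla_uJ(u^{k+1}))$. Tracking Assumption. For some $r_\alpha,r_u>0$: (i) There is $S_u\in C^1(\mathscr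 A_{2r};U)$ with $G(S_u(\alpha);\alpha)=0$ for all $\alpha\in\mathscr A_{2r}:=B(\widehat\alpha,2r_\alpha)\cap\operatorname{dom}R$, and, for a positive definite (in particular invertible) self-adjoint $Q\in\mathbb L(U;U)$, $\|S_u(\alpha_1)-S_u(\alpha_2)\|_Q\le L_{S_u}\|\alpha_1-\alpha_2\|$ for $\alpha_1,\alpha_2\in\mathscr A_{2r}$. (ii) $A_u$ satisfies $\kappa_u\|A_u(u,\alpha_2)-S_u(\alpha_2)\|_Q\le\|u-S_u(\alpha_1)\|_Q+\pi_u\|\alpha_2-\alpha_1\|$ for all $u\in B_Q(\widehat u,r_u)$, $\alpha_1,\alpha_2\in\mathscr A_{2r}$, with $\pi_u>0$, $\kappa_u>1$. (iii) $A_p$ satisfies $\kappa_p\|A_p(u,p,\alpha_2)-\nabla_\alpha S_u(\alpha_2)\|_{Q^{-1}}\le\|p-\nabla_\alpha S_u(\alpha_1)\|_{Q^{-1}}+C_S\|u-S_u(\alpha_2)\|_Q+\pi_p\|\alpha_2-\alpha_1\|$ for all $p\in\mathbb L(U;\mathscr A)$, $u\in B_Q(\widehat u,r_u)$, $\alpha_1,\alpha_2\in\mathscr A_{2r}$, with $C_S,\pi_p>0$, $\kappa_p>1$. (iv) $\nabla_uJ$ is Lipschitz with factor $L_{\nabla J}$ (in the norm $\|\cdot\|_Q$), and $J\circ S_u$ is $\gamma_\alpha$-strongly convex with $L_\alpha$-Lipschitz gradient in $B(\widehat\alpha,r)\cap\operatorname{dom}R$ ($r$ as in (vi)) for some $\gamma_\alpha,L_\alpha>0$.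 Moreover, for some $C_R\ge0$, $\|D(\alpha)-D(\widehat\alpha)\|\le\sigma C_R\|\alpha-\widehat\alpha\|$ for all $\alpha\in B(\widehat\alpha,r_\alpha)\cap\operatorname{dom}R$, where $D(\alpha):=\operatorname{prox}_{\sigma R}(\alpha-\sigma\widehat p\,\nabla_uJ(\widehat u))-\alpha$. (v) For constants $C_u,C_p>0$: $\|u^1-S_u(\alpha^0)\|_Q\le C_u\|\alpha^0-\widehat\alpha\|$, $\|p^1-\nabla_\alpha S_u(\alpha^0)\|_{Q^{-1}}\le C_p\|\alpha^0-\widehat\alpha\|$, $C_S\kappa_u^{-1}C_u<(\kappa_p-1)C_p$ and $C_\alpha:=L_{\nabla J}N_pC_u+N_{\nabla J}C_p<\gamma_\alpha$, where $N_p:=N_{\nabla S_u}+C_pr_\alpha$, $N_{\nabla J}:=\max\|\nabla_uJ(S_u(\alpha))\|_Q$, $N_{\nabla S_u}:=\max\|\nabla_\alpha S_u(\alpha)\|_{Q^{-1}}$, both maxima over $\alpha\in B(\widehat\alpha,r_\alpha)\cap\operatorname{dom}R$. (vi) $\alpha^0\in B(\widehat\alpha,r)$ with $r:=\min\{r_\alpha,r_u/(C_u+L_{S_u})\}$. (vii) $0<\sigma\le\frac{1}{C_\alpha+L_\alpha+C_R}\min\left\{\frac{(\kappa_u-1)C_u}{\pi_u+\kappa_uC_u},\frac{(\kappa_p-1)C_p-C_S\kappa_u^{-1}C_u}{\pi_p+\kappa_pC_p+C_S\kappa_u^{-1}\pi_u}\right\}$ and $\sigma<(\gamma_\alpha-C_\alpha)\frac{2}{L_\alpha^2}$.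 *)

(* Defs.v *)
From HB Require Import structures.
From mathcomp Require Import all_boot all_order all_algebra.
From mathcomp Require Import boolp classical_sets functions reals.
From mathcomp Require Import ereal topology normedtype sequences derive.
From mathcomp Require Import convex.

Set Implicit Arguments.
Unset Strict Implicit.
Unset Printing Implicit Defensive.

Import Order.TTheory GRing.Theory Num.Theory.
Import numFieldNormedType.Exports.

Local Open Scope classical_set_scope.
Local Open Scope ring_scope.

HB.mixin Record CompleteNormedModule_isHilbert (R : realType) V
    & CompleteNormedModule R V := {
  inner : V -> V -> R ;
  innerC : forall x y, inner x y = inner y x ;
  inner_linearl : forall y, scalar (inner ^~ y) ;
  inner_norm : forall x, inner x x = `|x| ^+ 2
}.

#[short(type="hilbertType")]
HB.structure Definition Hilbert (R : realType) :=
  {V of CompleteNormedModule R V & CompleteNormedModule_isHilbert R V}.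

Section BoundedOperators.
Context {R : realType}.

Record bounded_op (X Y : hilbertType R) := BoundedOp {
  bounded_op_linear :> {linear X -> Y} ;
  bounded_op_continuous : continuous bounded_op_linear
}.

Definition opnorm (X Y : hilbertType R) (T : X -> Y) : R :=
  sup [set `|T x| | x in [set x | `|x| <= 1]].

(* For continuous linear T the vector selected by get exists and is unique by
   the Riesz representation theorem, hence this is the Hilbert adjoint. *)
Definition adjoint (X Y : hilbertType R) (T : X -> Y) (y : Y) : X :=
  get [set x | forall h, inner x h = inner y (T h)].

Definition gradient (X : hilbertType R) (F : X -> R) (x : X) : X :=
  get [set g | forall h, inner g h = 'd (F : X -> R^o) x h].

Definition grad_u (U A : hilbertType R) (G : (U * A)%type -> U) (u : U) (a : A)
  : U -> U := adjoint (fun h : U => 'd G (u, a) (h, 0)).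

Definition grad_alpha (U A : hilbertType R) (G : (U * A)%type -> U)
  (u : U) (a : A) : U -> A := adjoint (fun h : A => 'd G (u, a) (0, h)).

Definition self_adjoint (X : hilbertType R) (T : X -> X) : Prop :=
  forall x y, inner (T x) y = inner x (T y).

Definition pos_def (X : hilbertType R) (Q : bounded_op X X) : Prop :=
  [/\ self_adjoint Q,
      forall x, x != 0 -> 0 < inner (Q x) x &
      exists Qi : bounded_op X X, cancel Q Qi /\ cancel Qi Q].

(* T = Q^(-1/2): the positive semi-definite self-adjoint T with T^2 = Q^(-1);
   for positive definite Q there is exactly one such T. *)
Definition is_inv_sqrt (X : hilbertType R) (Q T : bounded_op X X) : Prop :=
  [/\ self_adjoint T,
      forall x, 0 <= inner (T x) x,
      cancel Q (T \o T) &
      cancel (T \o T) Q].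

Definition Qnorm (X : hilbertType R) (Q : X -> X) (x : X) : R :=
  Num.sqrt (inner (Q x) x).

(* ||p||_(Q^-1) = ||p Q^(-1/2)||, with Qih standing for Q^(-1/2). *)
Definition Qinv_norm (X Y : hilbertType R) (Qih : X -> X) (p : X -> Y) : R :=
  opnorm (p \o Qih).

End BoundedOperators.

Section Convexity.
Context {R : realType} (X : hilbertType R).

Definition edom (f : X -> \bar R) : set X := [set x | (f x < +oo)%E].

Definition eproper (f : X -> \bar R) : Prop :=
  (forall x, (-oo < f x)%E) /\ edom f !=set0.

Definition econvex (f : X -> \bar R) : Prop :=
  forall (x y : X) (t : R), 0 <= t <= 1 ->
    (f (t *: x + (1 - t) *: y)%R <= t%:E * f x + (1 - t)%:E * f y)%E.

Definition subdifferential (f : X -> \bar R) (x : X) : set X :=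
  [set q | forall y, (f x + (inner q (y - x))%:E <= f y)%E].

(* The minimiser exists and is unique for f convex, proper and lower
   semicontinuous. *)
Definition prox (f : X -> \bar R) (x : X) : X :=
  get [set z | forall y, ((2^-1 * `|z - x| ^+ 2)%:E + f z <=
                          (2^-1 * `|y - x| ^+ 2)%:E + f y)%E].

Definition strongly_convex_on (D : set X) (gamma : R) (F : X -> R) : Prop :=
  forall (x y : X) (t : R), D x -> D y -> 0 <= t <= 1 ->
    F (t *: x + (1 - t) *: y) + gamma / 2 * (t * (1 - t)) * `|x - y| ^+ 2
      <= t * F x + (1 - t) * F y.

End Convexity.

Section DifferentiabilityOnSets.
Context {R : realType}.

(* Fréchet derivative relative to a set. The sets of interest are intersections
   of a ball with a domain and may have empty interior, so a function given on
   them need not have a derivative in the whole space. *)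
Definition is_derivative_on (X : hilbertType R) (Y : normedModType R)
    (D : set X) (F : X -> Y) (x : X) (T : X -> Y) : Prop :=
  forall eps : R, 0 < eps -> \forall y \near within D (nbhs x),
    `|F y - F x - T (y - x)| <= eps * `|y - x|.

(* F is C^1 on D with derivative dF. In the relative sense D need not determine
   dF, so the derivative is carried along as data. *)
Definition C1_on (X Y : hilbertType R) (D : set X) (F : X -> Y)
    (dF : X -> bounded_op X Y) : Prop :=
  (forall x, D x -> is_derivative_on D F x (dF x)) /\
  (forall x, D x ->
     opnorm (fun h => dF y h - dF x h) @[y --> within D (nbhs x)] --> (0 : R)).

(* F has the gradient gF relative to D, and gF is L-Lipschitz on D. For a
   composition F = J \o S the gradient gF is the one of the chain rule,
   gF x = (dS x)^* (gradient J (S x)). *)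
Definition lipschitz_gradient_on (X : hilbertType R) (D : set X) (L : R)
    (F : X -> R) (gF : X -> X) : Prop :=
  (forall x, D x -> is_derivative_on D (F : X -> R^o) x (inner (gF x))) /\
  (forall x y, D x -> D y -> `|gF x - gF y| <= L * `|x - y|).

End DifferentiabilityOnSets.

Section Algorithm.
Context {R : realType} (U A : hilbertType R).
Context (Reg : A -> \bar R) (J : U -> R) (sigma : R).
Context (Au : U -> A -> U) (Ap : U -> bounded_op U A -> A -> bounded_op U A).
Context (D : set A) (S : A -> U) (gradS : A -> U -> A).
Context (Q Qih : bounded_op U U).
Context (kappa_u kappa_p pi_u pi_p CS : R).

(* The convention alpha^(-1) := alpha^0 is provided by 0.-1 = 0. *)
Record generated_by_algorithm (u : nat -> U) (p : nat -> bounded_op U A)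
    (alpha : nat -> A) : Prop := GeneratedByAlgorithm {
  alg_init : edom Reg (alpha 0) ;
  alg_inner : forall k, u k.+1 = Au (u k) (alpha k) ;
  alg_inner_tracking : forall k, D (alpha k) -> D (alpha k.-1) ->
    kappa_u * Qnorm Q (u k.+1 - S (alpha k)) <=
      Qnorm Q (u k - S (alpha k.-1)) + pi_u * `|alpha k - alpha k.-1| ;
  alg_adjoint : forall k, p k.+1 = Ap (u k.+1) (p k) (alpha k) ;
  alg_adjoint_tracking : forall k, D (alpha k) -> D (alpha k.-1) ->
    kappa_p * Qinv_norm Qih (p k.+1 \- gradS (alpha k)) <=
      Qinv_norm Qih (p k \- gradS (alpha k.-1))
      + CS * Qnorm Q (u k.+1 - S (alpha k)) + pi_p * `|alpha k - alpha k.-1| ;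
  alg_outer : forall k, alpha k.+1 =
    prox (fun a => (sigma%:E * Reg a)%E)
         (alpha k - sigma *: p k.+1 (gradient J (u k.+1)))
}.

End Algorithm.

(* For nonnegative x this is Q-linear convergence, from the first term on. *)
Definition cvg0_linearly {R : realType} (x : nat -> R) : Prop :=
  x @ \oo --> (0 : R) /\
  exists mu : R, 0 <= mu < 1 /\ forall n, x n.+1 <= mu * x n.

(* Main.v *)
Require Import Defs.
From HB Require Import structures.
From mathcomp Require Import all_boot all_order all_algebra.
From mathcomp Require Import boolp classical_sets functions reals.
From mathcomp Require Import ereal topology normedtype sequences derive.
From mathcomp Require Import convex.
From mathcomp Require Import ring lra.

Set Implicit Arguments.
Unset Strict Implicit.
Unset Printing Implicit Defensive.

Import Order.TTheory GRing.Theory Num.Theory.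
Import numFieldNormedType.Exports.

Local Open Scope classical_set_scope.
Local Open Scope ring_scope.

(** The method is an inexact forward-backward splitting for
    J (S alpha) + R alpha. With exact inner and adjoint solves it would be
      alpha^(k+1) = prox (alpha^k - sigma * grad (J o S) (alpha^k)),
    and the point ahat is a fixed point of this map. Since J o S is strongly
    convex with a Lipschitz gradient, the exact forward step contracts the
    distance to ahat for small sigma ([strongly_convex_gradient_monotone],
    [gradient_step_contraction]), and the backward step does not increase it
    ([prox_nonexpansive]).

    The inexactness is controlled by an induction on three bounds at once:
    with e_n = |alpha^n - ahat|, the iterate stays in the ball of radius r, the
    state error is at most C_u * e_n and the adjoint error at most C_p * e_n.
    - Given the two error bounds, the gradient used by the algorithm is within
      C_a * e_n of the true one ([apply_difference_bound]). As C_a < gamma_a,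
      the perturbation is absorbed by strong convexity, and e_(n+1) <= c * e_n
      for a factor c < 1 independent of n ([contraction_factor_lt1]).
    - The same gradient bound, together with the assumption on the residual D,
      shows that the outer step has length at most
      sigma * (C_a + L_a + C_R) * e_n. This makes the target of the inner and
      adjoint solvers move slowly: the upper bound on sigma says exactly that
      their contraction (kappa_u, kappa_p > 1) outweighs both this drift and the
      possible decrease from e_n to e_(n+1) ([tracking_error_step]).

    Two existence facts have to be settled first, since adjoints and proximal
    points are selected by a choice operator: Riesz representatives and
    proximal points exist. Both are minimizers of a strongly convex function,
    whose minimizing sequences are Cauchy ([minimizer_exists]). *)

(** * Inner products *)

Section InnerProduct.
Context {R : realType} {X : hilbertType R}.
Implicit Types (x y z h : X) (a : R).

Lemma innerDl x y z : inner (x + y) z = inner x z + inner y z.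
Proof. by have := inner_linearl z 1 x y; rewrite scale1r mul1r. Qed.

Lemma inner0l z : inner 0 z = 0.
Proof. by have := innerDl 0 0 z; rewrite addr0; lra. Qed.

Lemma innerZl a x z : inner (a *: x) z = a * inner x z.
Proof. by have := inner_linearl z a x 0; rewrite addr0 inner0l addr0. Qed.

Lemma innerNl x z : inner (- x) z = - inner x z.
Proof. by rewrite -scaleN1r innerZl mulN1r. Qed.

Lemma innerBl x y z : inner (x - y) z = inner x z - inner y z.
Proof. by rewrite innerDl innerNl. Qed.

Lemma innerDr x y z : inner x (y + z) = inner x y + inner x z.
Proof. by rewrite innerC innerDl ![inner _ x]innerC. Qed.

Lemma innerZr a x z : inner x (a *: z) = a * inner x z.
Proof. by rewrite innerC innerZl innerC. Qed.

Lemma innerNr x z : inner x (- z) = - inner x z.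
Proof. by rewrite innerC innerNl innerC. Qed.

Lemma innerBr x y z : inner x (y - z) = inner x y - inner x z.
Proof. by rewrite innerDr innerNr. Qed.

Definition innerE := (innerDl, innerDr, innerBl, innerBr, innerNl, innerNr,
  innerZl, innerZr).

Lemma normD_sqr x y : `|x + y| ^+ 2 = `|x| ^+ 2 + 2 * inner x y + `|y| ^+ 2.
Proof. by rewrite -!inner_norm !innerE (innerC y x); ring. Qed.

Lemma normB_sqr x y : `|x - y| ^+ 2 = `|x| ^+ 2 - 2 * inner x y + `|y| ^+ 2.
Proof. by rewrite -!inner_norm !innerE (innerC y x); ring. Qed.

(** Expanding the square norm of |y| x - |x| y, which is nonnegative, gives
    the inequality multiplied by 2 |x| |y|. *)
Lemma cauchy_schwarz x y : inner x y <= `|x| * `|y|.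
Proof.
have : 0 <= `| `|y| *: x - `|x| *: y| ^+ 2 by exact: sqr_ge0.
rewrite normB_sqr !normrZ !normr_id innerZl innerZr.
have [->|x0] := eqVneq x 0; first by rewrite inner0l normr0 mul0r.
have [->|y0] := eqVneq y 0; first by rewrite innerC inner0l normr0 mulr0.
have xy : 0 < `|x| * `|y| by rewrite mulr_gt0 ?normr_gt0.
move=> h; rewrite -subr_ge0 -(pmulr_rge0 _ xy); lra.
Qed.

Lemma inner_inj x y : (forall h, inner x h = inner y h) -> x = y.
Proof.
move=> h; apply/eqP; rewrite -subr_eq0 -normr_eq0 -sqrf_eq0.
by rewrite -inner_norm innerBl h subrr.
Qed.

End InnerProduct.

(** * Minimization of strongly convex functions *)

Section Minimization.
Context {R : realType} {X : hilbertType R}.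

(** The midpoint inequality is strong convexity with modulus 1 tested at t = 1/2,
    phrased through real upper bounds so that infinite values need no separate
    treatment. It bounds the distance of two almost minimizers by their excess
    over the infimum; a minimizing sequence is therefore Cauchy, and lower
    semicontinuity makes its limit a minimizer. *)
Lemma minimizer_exists (F : X -> \bar R) (m : R) :
  (forall x, m%:E <= F x)%E -> (exists x, F x < +oo)%E ->
  lower_semicontinuous F ->
  (forall x y (a b : R), (F x <= a%:E)%E -> (F y <= b%:E)%E ->
     (F (2^-1 *: (x + y)) <= (2^-1 * (a + b) - 8^-1 * `|x - y| ^+ 2)%:E)%E) ->
  exists z, forall y, (F z <= F y)%E.
Proof.
move=> Fm [x0 Fx0] lsc mid.
pose V := [set a : R | exists x, (F x <= a%:E)%E].
have Vlb : lbound V m.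
  by move=> a [x Fx]; rewrite -lee_fin (le_trans (Fm x)).
have V0 : V !=set0.
  exists (fine (F x0)); exists x0; rewrite fineK // fin_numElt Fx0 andbT.
  by rewrite (lt_le_trans _ (Fm x0)) ?ltNyr.
have hV : has_inf V by split => //; exists m.
pose I := inf V.
have IV a x : (F x <= a%:E)%E -> I <= a.
  by move=> Fx; apply: ge_inf; [exists m|exists x].
have /choice[x Fx] : forall n : nat, exists x : X, (F x <= (I + n.+1%:R^-1)%:E)%E.
  move=> n; have n0 : 0 < n.+1%:R^-1 :> R by rewrite invr_gt0.
  have [a [x Fx] aI] := inf_adherent n0 hV.
  by exists x; rewrite (le_trans Fx)// lee_fin ltW.
have xx n k : `|x n - x k| ^+ 2 <= 4 * (n.+1%:R^-1 + k.+1%:R^-1).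
  have := IV _ _ (mid _ _ _ _ (Fx n) (Fx k)).
  by move: n.+1%:R^-1 k.+1%:R^-1 (`|x n - x k| ^+ 2) => c d s; lra.
have /cauchy_cvg/cvg_ex[z /= xz] : cauchy (x @ \oo).
  apply/cauchyP => e e0; have d0 : 0 < 8^-1 * e ^+ 2 by rewrite mulr_gt0 ?exprn_gt0.
  have [N _ HN] := near_infty_natSinv_lt (PosNum d0).
  exists (x N); exists N => // n /= Nn.
  rewrite -ball_normE /=.
  rewrite -(ltr_pXn2r (n := 2)) ?nnegrE ?normr_ge0 ?ltW//.
  have := HN N (leqnn N); have := HN n Nn; have := xx N n => /=.
  by move: N.+1%:R^-1 n.+1%:R^-1 (`|x N - x n| ^+ 2) (e ^+ 2) => *; lra.
exists z => y.
suff Fz : (F z <= I%:E)%E.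
  case Fy : (F y) => [b| |]; last by have := Fm y; rewrite Fy leeNy_eq.
    by rewrite (le_trans Fz)// lee_fin (IV b y)// Fy.
  by rewrite leey.
rewrite leNgt; apply/negP => IFz.
have [e e0 IeF] : exists2 e : R, 0 < e & ((I + e)%:E < F z)%E.
  case: (F z) IFz => [b| |] //; last by exists 1 => //; rewrite ltry.
  rewrite lte_fin => Ib; exists (2^-1 * (b - I)); rewrite ?lte_fin; lra.
have [W Wz WF] := lsc _ _ IeF.
have [n [Wn ne]] : exists n, W (x n) /\ (n.+1%:R^-1 < e :> R).
  by near \oo => n; exists n; split; near: n;
    [exact: xz|exact: (near_infty_natSinv_lt (PosNum e0))].
have := lt_le_trans (WF _ Wn) (Fx n); rewrite lte_fin.
by move: n.+1%:R^-1 ne => c ce; lra.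
Unshelve. all: by end_near. Qed.

End Minimization.

(** * Riesz representation, adjoints and operator norms *)

Section Operators.
Context {R : realType}.

(** First-order optimality in one variable: 0 minimizes t * a + t^2 * b only
    if a vanishes; for b > 0 the vertex t = - a / (2 b) is the test point. *)
Lemma linear_term_eq0 (a b : R) : (forall t, 0 <= t * a + t ^+ 2 * b) -> a = 0.
Proof.
move=> h; have [b0|b0] := leP b 0.
  by have := h 1; have := h (-1); rewrite !expr2; nra.
have bE : b / b = 1 by rewrite divff // gt_eqF.
have := h (- (2^-1 * a / b)).
rewrite (_ : _ + _ = - (4^-1 * a ^+ 2 / b)); last first.
  by rewrite !expr2; field; rewrite gt_eqF.
rewrite oppr_ge0 pmulr_lle0 ?invr_gt0// => a2.
apply/eqP; rewrite -sqrf_eq0 eq_le sqr_ge0 andbT; lra.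
Qed.

Lemma bounded_op_bound (X Y : hilbertType R) (T : bounded_op X Y) :
  exists2 C : R, 0 <= C & forall x, `|T x| <= C * `|x|.
Proof.
have /linear_boundedP [M [_ HM]] : bounded_near T (nbhs (0 : X)).
  by apply: continuous_linear_bounded; exact: bounded_op_continuous.
exists (`|M| + 1) => [|x]; first by rewrite addr_ge0.
by apply: HM; rewrite ltr_pwDr // ler_norm.
Qed.

(** The representative minimizes |x|^2 / 2 - f x; varying the minimizer along a
    direction h identifies inner z h with f h. *)
Lemma riesz_representation (X : hilbertType R) (f : {linear X -> R^o}) (C : R) :
  (forall x, `|f x| <= C * `|x|) -> exists z, forall h, inner z h = f h.
Proof.
move=> fC.
pose F x : \bar R := (2^-1 * `|x| ^+ 2 - f x)%:E.
have cf : continuous f.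
  apply/linear_bounded_continuous/linear_boundedP.
  exists C; split; first exact: num_real.
  by move=> M CM x; rewrite (le_trans (fC x)) // ler_wpM2r // ltW.
have [|||x y a b|z zmin] := @minimizer_exists R X F (- (2^-1 * C ^+ 2)).
- move=> x; rewrite lee_fin; have := fC x; have := ler_norm (f x).
  by have := sqr_ge0 (C - `|x|); rewrite !expr2; nra.
- by exists 0; rewrite ltry.
- have cF : continuous (fun x => 2^-1 * `|x| ^+ 2 - f x : R^o).
    move=> x; apply: cvgB; last exact: cf.
    apply: cvgM; first exact: cvg_cst.
    by apply: cvgM; apply: norm_continuous.
  move=> x a; rewrite lte_fin => ax.
  exists [set y | a < 2^-1 * `|y| ^+ 2 - f y] => //=.
  exact: (cvgr_gt _ (cF x) a ax).
- rewrite !lee_fin => Fa Fb.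
  have -> : f (2^-1 *: (x + y)) = 2^-1 * (f x + f y).
    by rewrite linearZ linearD.
  rewrite normrZ exprMn normB_sqr normD_sqr ger0_norm // (expr2 2^-1).
  lra.
exists z => h; apply/eqP; rewrite -subr_eq0; apply/eqP.
apply: (@linear_term_eq0 _ (2^-1 * `|h| ^+ 2)) => t.
have := zmin (z + t *: h); rewrite lee_fin normD_sqr.
have -> : f (z + t *: h) = f z + t * f h by rewrite linearD linearZ.
rewrite normrZ exprMn real_normK ?num_real// innerZr; lra.
Qed.

Lemma inner_adjoint (X Y : hilbertType R) (T : bounded_op X Y) y h :
  inner (adjoint T y) h = inner y (T h).
Proof.
rewrite /adjoint.
suff /getPex : exists x, forall k, inner x k = inner y (T k) by [].
have lin : linear (fun k => inner y (T k) : R^o).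
  by move=> a k l; rewrite linearP innerDr innerZr.
pose f : {linear X -> R^o} :=
  HB.pack (fun k => inner y (T k) : R^o) (GRing.isLinear.Build _ _ _ _ _ lin).
have [C C0 TC] := bounded_op_bound T.
apply: (riesz_representation (f := f) (C := `|y| * C)) => k /=.
have := cauchy_schwarz y (T k); have := cauchy_schwarz y (- T k).
rewrite innerNr normrN => h1 h2.
rewrite (@le_trans _ _ (`|y| * `|T k|)) //.
  by rewrite ler_norml; apply/andP; split; lra.
by rewrite -mulrA ler_wpM2l.
Qed.

Lemma adjointZ (X Y : hilbertType R) (T : bounded_op X Y) a y :
  adjoint T (a *: y) = a *: adjoint T y.
Proof. by apply: inner_inj => h; rewrite innerZl !inner_adjoint innerZl. Qed.

(** From |T^* y|^2 = inner y (T (T^* y)) <= |y| C |T^* y|. *)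
Lemma adjoint_bound (X Y : hilbertType R) (T : bounded_op X Y) :
  exists2 C : R, 0 <= C & forall y, `|adjoint T y| <= C * `|y|.
Proof.
have [C C0 TC] := bounded_op_bound T; exists C => // y.
have [->|] := eqVneq (adjoint T y) 0; first by rewrite normr0 mulr_ge0.
rewrite -normr_gt0 => n0; rewrite -(ler_pM2r n0) -expr2 -inner_norm inner_adjoint.
rewrite (le_trans (cauchy_schwarz _ _)) // mulrC mulrAC.
by rewrite ler_wpM2r.
Qed.

Lemma opnorm_ge0 (X Y : hilbertType R) (T : X -> Y) : 0 <= opnorm T.
Proof.
rewrite /opnorm; set E := image _ _.
have E0 : E (`|T 0|) by exists 0 => //=; rewrite normr0.
have [ub|nub] := pselect (has_ubound E); last first.
  by rewrite sup_out // => -[].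
by rewrite (le_trans (normr_ge0 (T 0)))// ub_le_sup.
Qed.

(** Exactly what makes the supremum over the unit ball in [opnorm] an operator
    bound: a finite supremum, and homogeneity to rescale arguments. It covers
    bounded operators, adjoints and their differences alike. *)
Definition bounded_homogeneous (X Y : hilbertType R) (T : X -> Y) : Prop :=
  (forall a x, T (a *: x) = a *: T x) /\
  exists2 C : R, 0 <= C & forall x, `|T x| <= C * `|x|.

Lemma opnorm_bound (X Y : hilbertType R) (T : X -> Y) :
  bounded_homogeneous T -> forall x, `|T x| <= opnorm T * `|x|.
Proof.
move=> [TZ [C C0 TC]] x.
have [->|x0] := eqVneq x 0.
  by rewrite (le_trans (TC _))// normr0 !mulr0.
have n0 : 0 < `|x| by rewrite normr_gt0.
rewrite -ler_pdivrMr // mulrC.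
have -> : `|x|^-1 * `|T x| = `|T (`|x|^-1 *: x)|.
  by rewrite TZ normrZ normfV normr_id.
apply: ub_le_sup; last first.
  by exists (`|x|^-1 *: x) => //=; rewrite normrZ normfV normr_id mulVf ?gt_eqF.
exists C => _ [y /= y1 <-]; rewrite (le_trans (TC y))//.
by rewrite -[leRHS]mulr1 ler_wpM2l.
Qed.

Lemma bounded_homogeneous_op (X Y : hilbertType R) (T : bounded_op X Y) :
  bounded_homogeneous T.
Proof. by split; [move=> a x; rewrite linearZ|exact: bounded_op_bound]. Qed.

Lemma bounded_homogeneous_adjoint (X Y : hilbertType R) (T : bounded_op X Y) :
  bounded_homogeneous (adjoint T).
Proof. by split; [exact: adjointZ|exact: adjoint_bound]. Qed.

Lemma bounded_homogeneousB (X Y : hilbertType R) (S T : X -> Y) :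
  bounded_homogeneous S -> bounded_homogeneous T -> bounded_homogeneous (S \- T).
Proof.
move=> [SZ [C C0 SC]] [TZ [D D0 TD]]; split.
  by move=> a x /=; rewrite SZ TZ scalerBr.
exists (C + D) => [|x /=]; first exact: addr_ge0.
by rewrite (le_trans (ler_normB _ _))// mulrDl lerD.
Qed.

(** Writing x = Q^(-1/2) (Q^(-1/2) Q x) splits T x into T Q^(-1/2) applied to
    Q^(-1/2) Q x, and the norm of the latter is the Q-norm of x because
    Q^(-1/2) is self-adjoint. *)
Lemma Qinv_norm_bound (X Y : hilbertType R) (Q Qih : bounded_op X X)
    (T : X -> Y) : is_inv_sqrt Q Qih -> bounded_homogeneous T ->
  forall x, `|T x| <= Qinv_norm Qih T * Qnorm Q x.
Proof.
move=> [sa _ QTT TTQ] [TZ [C C0 TC]] x.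
have xE : Qih (Qih (Q x)) = x by exact: QTT.
have -> : Qnorm Q x = `|Qih (Q x)|.
  by rewrite /Qnorm -{2}xE -sa inner_norm sqrtr_sqr normr_id.
have [D D0 QD] := bounded_op_bound Qih.
rewrite -{1}xE; apply: (@opnorm_bound _ _ (T \o Qih)); split.
  by move=> a y /=; rewrite linearZ TZ.
exists (C * D) => [|y /=]; first exact: mulr_ge0.
by rewrite (le_trans (TC _))// -mulrA ler_wpM2l.
Qed.

End Operators.

(** * Convex functions, subgradients and the proximal map *)

Section Proximal.
Context {R : realType} {X : hilbertType R}.

Lemma econvex_le (g : X -> \bar R) x y (a b t : R) : econvex g ->
  (g x <= a%:E)%E -> (g y <= b%:E)%E -> 0 <= t <= 1 ->
  (g (t *: x + (1 - t) *: y)%R <= (t * a + (1 - t) * b)%:E)%E.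
Proof.
move=> cg ga gb t01; rewrite (le_trans (cg _ _ _ t01))//.
rewrite (EFinD (t * a)) !EFinM leeD // lee_wpmul2l // lee_fin; lra.
Qed.

Lemma lower_semicontinuous_addl (f : X -> R) (g : X -> \bar R) :
  continuous f -> (forall x, -oo < g x)%E -> lower_semicontinuous g ->
  lower_semicontinuous (fun x => (f x)%:E + g x)%E.
Proof.
move=> cf gNy lsc x a; rewrite -lteBlDl // -EFinB => agx.
have [e e0 aegx] : exists2 e : R, 0 < e & ((a - f x + e)%:E < g x)%E.
  case: (g x) (gNy x) agx => [b| |] // _; last by exists 1 => //; rewrite ltry.
  rewrite lte_fin => ab; exists (2^-1 * (b - (a - f x))); rewrite ?lte_fin; lra.
have [W Wx Wg] := lsc _ _ aegx.
have fxe : f x - e < f x by lra.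
exists (W `&` [set y | f x - e < f y]).
  by apply: filterI => //; exact: (cvgr_gt _ (cf x) _ fxe).
move=> y [Wy /= fy]; rewrite (_ : a = (f x - e) + (a - f x + e)); last by ring.
by rewrite EFinD lteD ?lte_fin // Wg.
Qed.

Lemma subdifferential_edom (g : X -> \bar R) x q :
  eproper g -> subdifferential g x q -> edom g x.
Proof.
move=> [gNy [y gy]] /(_ y); rewrite /edom /=; have := gNy x.
case: (g x) => [a| |] // _.
by rewrite addye // leye_eq => /eqP gyy; move: gy; rewrite /edom /= gyy.
Qed.

Lemma proper_fineK (g : X -> \bar R) x : eproper g -> edom g x ->
  g x = (fine (g x))%:E.
Proof. by move=> [gNy _] gx; rewrite fineK // fin_numElt gNy. Qed.

Lemma econvex_edom (g : X -> \bar R) x y (t : R) : econvex g -> eproper g ->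
  edom g x -> edom g y -> 0 <= t <= 1 -> edom g (t *: x + (1 - t) *: y).
Proof.
move=> cg pg gx gy t01.
have gxb : (g x <= (fine (g x))%:E)%E by rewrite -proper_fineK.
have gyb : (g y <= (fine (g y))%:E)%E by rewrite -proper_fineK.
by rewrite /edom /= (le_lt_trans (econvex_le cg gxb gyb t01)) // ltry.
Qed.

Lemma subdifferential_monotone (g : X -> \bar R) x y p q : eproper g ->
  subdifferential g x p -> subdifferential g y q -> 0 <= inner (p - q) (x - y).
Proof.
move=> pg gp gq; have gx := subdifferential_edom pg gp.
have gy := subdifferential_edom pg gq; have := gp y; have := gq x.
rewrite (proper_fineK pg gx) (proper_fineK pg gy) !lee_fin !innerE; lra.
Qed.

Lemma subdifferential_scale (g : X -> \bar R) (s : R) x q : 0 < s ->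
  subdifferential g x q ->
  subdifferential (fun y => (s%:E * g y)%E) x (s *: q).
Proof.
move=> s0 gq y; rewrite innerZl EFinM -muleDr //.
  by apply: lee_wpmul2l (gq y); rewrite lee_fin ltW.
by rewrite fin_num_adde_defl.
Qed.

Lemma econvex_scale (g : X -> \bar R) (s : R) : 0 < s -> eproper g ->
  econvex g -> econvex (fun y => (s%:E * g y)%E).
Proof.
move=> s0 [gNy _] cg x y t t01; have [t0 t1] := andP t01.
have gtNy (c : R) z : 0 <= c -> (-oo < c%:E * g z)%E.
  move=> c0; case: (g z) (gNy z) => [b| |] // _; first by rewrite ltNyr.
  by rewrite (lt_le_trans (ltNyr 0)) // mule_ge0 ?lee_fin ?leey.
have t1' : 0 <= 1 - t by lra.
rewrite (muleCA t%:E) (muleCA (1 - t)%:E) -muleDr //; last first.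
  by rewrite ltninfty_adde_def // inE gtNy.
by apply: lee_wpmul2l (cg _ _ _ t01); rewrite lee_fin ltW.
Qed.

Lemma eproper_scale (g : X -> \bar R) (s : R) : 0 < s -> eproper g ->
  eproper (fun y => (s%:E * g y)%E).
Proof.
move=> s0 pg; have [gNy [y gy]] := pg; split=> [x|].
  case: (g x) (gNy x) => [b| |] // _; first by rewrite ltNyr.
  by rewrite gt0_muley // lte_fin.
by exists y; rewrite /edom /= (proper_fineK pg gy) -EFinM ltry.
Qed.

Lemma edom_scale (g : X -> \bar R) (s : R) : 0 < s ->
  edom (fun y => (s%:E * g y)%E) = edom g.
Proof.
move=> s0; apply/seteqP; split => x; rewrite /edom /=.
  by case: (g x) => [b| |] //; rewrite ?ltry // gt0_muley // lte_fin.
by case: (g x) => [b| |] // _; rewrite ?ltry // gt0_muleNy // lte_fin.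
Qed.

Lemma lower_semicontinuous_scale (g : X -> \bar R) (s : R) : 0 < s ->
  lower_semicontinuous g -> lower_semicontinuous (fun y => (s%:E * g y)%E).
Proof.
move=> s0 lsc x a; have sE z : (a%:E < s%:E * g z)%E = ((s^-1 * a)%:E < g z)%E.
  have := @lte_pdivlMl R s^-1 (g z) a%:E; rewrite invrK invr_gt0 => /(_ s0) ->.
  by rewrite EFinM.
by rewrite sE => /lsc[W Wx Wg]; exists W => // y; rewrite sE => /Wg.
Qed.

(** A subgradient at one point is an affine minorant of g, so adding the
    quadratic term gives a function bounded below; the quadratic term also
    supplies the strong convexity that [minimizer_exists] asks for. *)
Lemma prox_minimizes (g : X -> \bar R) x0 q x : econvex g -> eproper g ->
  lower_semicontinuous g -> subdifferential g x0 q ->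
  forall y, ((2^-1 * `|prox g x - x| ^+ 2)%:E + g (prox g x) <=
             (2^-1 * `|y - x| ^+ 2)%:E + g y)%E.
Proof.
move=> cg pg lsc gq.
have [gNy _] := pg; have gx0 := subdifferential_edom pg gq.
suff /getPex : exists z, forall y, ((2^-1 * `|z - x| ^+ 2)%:E + g z <=
    (2^-1 * `|y - x| ^+ 2)%:E + g y)%E by [].
apply: (@minimizer_exists R X _
  (fine (g x0) + inner q (x - x0) - 2^-1 * `|q| ^+ 2)).
- move=> y; have := gq y; rewrite (proper_fineK pg gx0).
  case: (g y) (gNy y) => [b| |] // _; last by rewrite addey ?leey.
  rewrite !lee_fin => h; have := sqr_ge0 `|q + (y - x)|.
  by rewrite normD_sqr; move: h; rewrite !innerE; lra.
- by exists x0; rewrite (proper_fineK pg gx0) -EFinD ltry.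
- apply: lower_semicontinuous_addl => // y.
  apply: cvgM; first exact: cvg_cst.
  by apply: cvgM; apply: cvg_norm; apply: cvgB => //; exact: cvg_cst.
- have h01 : 0 <= (2^-1 : R) <= 1 by lra.
  (* The midpoint inequality is the convexity of g combined with the
     parallelogram law for y - x and z - x. *)
  move=> y z a b; rewrite -!leeBrDl // -!EFinB => gy gz.
  have := econvex_le cg gy gz h01.
  rewrite (_ : 2^-1 *: y + _ = 2^-1 *: (y + z)); last first.
    by rewrite scalerDr; congr (_ + _ *: _); lra.
  move=> /le_trans; apply; rewrite lee_fin.
  rewrite (_ : 2^-1 *: (y + z) - x = 2^-1 *: ((y - x) + (z - x))); last first.
    rewrite addrACA -opprD scalerBr -(mulr2n x) -(scaler_nat 2 x) scalerA.
    by rewrite mulVf ?scale1r.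
  rewrite (_ : y - z = (y - x) - (z - x)); last by rewrite opprB addrA subrK.
  rewrite normrZ exprMn (normB_sqr (y - x)) (normD_sqr (y - x)) ger0_norm //.
  rewrite (expr2 2^-1); lra.
Qed.

(** Compare the value at the minimizer z with that at z + t (y - z): dividing by t
    leaves the subgradient inequality up to the error t |y - z|^2 / 2. *)
Lemma subdifferential_prox (g : X -> \bar R) x0 q x : econvex g -> eproper g ->
  lower_semicontinuous g -> subdifferential g x0 q ->
  subdifferential g (prox g x) (x - prox g x).
Proof.
move=> cg pg lsc gq; have zmin := prox_minimizes x cg pg lsc gq.
have [gNy _] := pg; have gx0 := subdifferential_edom pg gq.
set z := prox g x in zmin *.
have gz : edom g z.
  have := zmin x0; rewrite (proper_fineK pg gx0) -EFinD /edom /=.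
  by case: (g z) => [b| |] //=; rewrite ?ltry.
move=> y; rewrite (proper_fineK pg gz).
case gyE : (g y) (gNy y) => [b| |] // _; last by rewrite leey.
rewrite lee_fin; set c := fine (g z).
apply/ler_addgt0Pl => e e0.
have [t t01 te] : exists2 t : R, 0 < t <= 1 & 2^-1 * t * `|y - z| ^+ 2 <= e.
  have M0 : 0 <= 2^-1 * `|y - z| ^+ 2 by rewrite mulr_ge0 // exprn_ge0.
  set N := `|y - z| ^+ 2 in M0 *.
  have Me : 0 < 2^-1 * N + e by lra.
  exists (e / (2^-1 * N + e)).
    by rewrite divr_gt0 //= ler_pdivrMr // mul1r lerDr.
  rewrite (_ : _ * N = e * (2^-1 * N / (2^-1 * N + e))); last by ring.
  by rewrite ger_pMr // ler_pdivrMr // mul1r; lra.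
have [t0 t1] := andP t01.
have t01' : 0 <= t <= 1 by rewrite ltW.
have gyb : (g y <= b%:E)%E by rewrite gyE.
have gzc : (g z <= c%:E)%E by rewrite /c -(proper_fineK pg gz).
have := le_trans (zmin (t *: y + (1 - t) *: z)) (leeD (lexx _)
  (econvex_le cg gyb gzc t01')).
rewrite (proper_fineK pg gz) -/c -!EFinD lee_fin.
rewrite (_ : t *: y + (1 - t) *: z - x = (z - x) + t *: (y - z)); last first.
  by rewrite scalerBl scale1r scalerBr addrCA addrAC.
rewrite (normD_sqr (z - x)) innerZr normrZ exprMn (ger0_norm (ltW t0)) => h.
rewrite -(ler_pM2l t0).
have -> : inner (x - z) (y - z) = - inner (z - x) (y - z).
  by rewrite -innerNl opprB.
have : t * (2^-1 * t * `|y - z| ^+ 2) <= t * e by rewrite ler_pM2l.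
move: h; rewrite (expr2 t); lra.
Qed.

(** Read x - v and y - w as subgradients at v and w: monotonicity of the
    subdifferential is the hypothesis, and Cauchy-Schwarz turns
    |v - w|^2 <= inner (x - y) (v - w) into the conclusion. *)
Lemma norm_le_of_monotone (x y v w : X) :
  0 <= inner ((x - v) - (y - w)) (v - w) -> `|v - w| <= `|x - y|.
Proof.
rewrite (_ : _ - _ - _ = (x - y) - (v - w)); last first.
  by rewrite !opprB addrACA [RHS]addrACA; congr (_ + _); rewrite addrC.
rewrite innerBl inner_norm subr_ge0 => h.
have := le_trans h (cauchy_schwarz _ _); rewrite expr2.
have [->|n0] := eqVneq `|v - w| 0; first by rewrite normr_ge0.
by rewrite ler_pM2r // lt_neqAle eq_sym n0 /=.
Qed.

Lemma prox_nonexpansive (g : X -> \bar R) x0 q x y : econvex g -> eproper g ->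
  lower_semicontinuous g -> subdifferential g x0 q ->
  `|prox g x - prox g y| <= `|x - y|.
Proof.
move=> cg pg lsc gq; apply: norm_le_of_monotone.
by apply: (subdifferential_monotone pg); exact: subdifferential_prox gq.
Qed.

(** x and prox (x + q) both satisfy the optimality condition for the centre
    x + q, so monotonicity bounds their distance by that of equal centres. *)
Lemma prox_fixpoint (g : X -> \bar R) x q : econvex g -> eproper g ->
  lower_semicontinuous g -> subdifferential g x q -> prox g (x + q) = x.
Proof.
move=> cg pg lsc gq; apply/eqP; rewrite -subr_eq0 -normr_le0.
rewrite -(normr0 X) -(subrr (x + q)); apply: norm_le_of_monotone.
apply: (subdifferential_monotone pg); first exact: subdifferential_prox gq.
by rewrite addrAC subrr add0r.
Qed.

End Proximal.

(** * Gradient steps on strongly convex functions *)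

Section StrongConvexity.
Context {R : realType} {X : hilbertType R}.

Lemma closed_ball_convex (a x y : X) (r t : R) :
  closed_ball_ Num.norm a r x -> closed_ball_ Num.norm a r y -> 0 <= t <= 1 ->
  closed_ball_ Num.norm a r (t *: x + (1 - t) *: y).
Proof.
rewrite /closed_ball_ /= => xr yr /andP[t0 t1].
rewrite (_ : _ - _ = t *: (a - x) + (1 - t) *: (a - y)); last first.
  by rewrite !scalerBr addrACA -opprD -scalerDl (addrC t) subrK scale1r.
rewrite (le_trans (ler_normD _ _)) // !normrZ !ger0_norm ?subr_ge0 //.
have : t * `|a - x| <= t * r by rewrite ler_wpM2l.
have : (1 - t) * `|a - y| <= (1 - t) * r by rewrite ler_wpM2l ?subr_ge0.
lra.
Qed.

(** The point x + t (y - x) stays in the convex set D, so a derivative relative to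
    D suffices: insert it in the strong convexity inequality, divide by t and
    let t tend to 0. *)
Lemma strongly_convex_gradient (D : set X) (gamma : R) (F : X -> R) x y g :
  0 <= gamma ->
  (forall v w (t : R), D v -> D w -> 0 <= t <= 1 -> D (t *: v + (1 - t) *: w)) ->
  strongly_convex_on D gamma F -> is_derivative_on D (F : X -> R^o) x (inner g) ->
  D x -> D y -> F x + inner g (y - x) + gamma / 2 * `|y - x| ^+ 2 <= F y.
Proof.
move=> gamma0 cD sc dF Dx Dy; apply/ler_addgt0Pl => e e0.
set N := `|y - x|; have N0 : 0 <= N by exact: normr_ge0.
have N1 : 0 < N + 1 by lra.
pose eps := 2^-1 * e / (N + 1).
have eps0 : 0 < eps by rewrite !(mulr_gt0, invr_gt0) ?ltr0n.
have epsN : eps * N <= 2^-1 * e.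
  rewrite /eps -mulrA ler_piMr ?mulr_ge0 ?(ltW e0) //.
  by rewrite mulrC ler_pdivrMr // mul1r; lra.
have /nbhs_ballP[d /= d0 Hd] := dF _ eps0.
pose M := gamma / 2 * N ^+ 2.
have M0 : 0 <= M by rewrite mulr_ge0 ?divr_ge0 ?exprn_ge0.
have M1 : 0 < M + 1 by lra.
(* t is small enough for the linearization to be accurate up to eps, and for
   the term t * gamma / 2 * N^2 of strong convexity to be below e / 2; the
   + 1 in the denominators covers N = 0. *)
have [t [t0 t1 td te]] : exists t : R,
    [/\ 0 < t, t < 1, t * N < d & t * M <= 2^-1 * e].
  exists (Num.min (2^-1) (Num.min (d / (N + 1)) (2^-1 * e / (M + 1)))).
  set s := Num.min _ _.
  have s0 : 0 < s by rewrite !lt_min !divr_gt0 ?mulr_gt0 ?invr_gt0 ?ltr0n.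
  have : s <= s by []; rewrite {2}/s !le_min !ler_pdivlMr // => /and3P[s1 s2 s3].
  by split => //; nra.
have tI : 0 <= t <= 1 by rewrite !ltW.
have zE : t *: y + (1 - t) *: x - x = t *: (y - x).
  by rewrite scalerBl scale1r scalerBr addrCA addrAC subrr add0r.
have := Hd (t *: y + (1 - t) *: x); rewrite -ball_normE /=.
rewrite -normrN opprB zE normrZ gtr0_norm // innerZr => /(_ td (cD _ _ _ Dy Dx tI)).
rewrite ler_norml => /andP[lo _]; have := sc _ _ _ Dy Dx tI.
move=> up; rewrite -(ler_pM2l t0).
have : t * (eps * N) <= t * (2^-1 * e) by rewrite ler_pM2l.
have : t * (t * M) <= t * (2^-1 * e) by rewrite ler_pM2l.
move: lo up; rewrite -/N /M; lra.
Qed.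

Lemma strongly_convex_gradient_monotone (D : set X) (gamma : R) (F : X -> R)
    (dF : X -> X) x y : 0 <= gamma ->
  (forall v w (t : R), D v -> D w -> 0 <= t <= 1 -> D (t *: v + (1 - t) *: w)) ->
  strongly_convex_on D gamma F ->
  (forall v, D v -> is_derivative_on D (F : X -> R^o) v (inner (dF v))) ->
  D x -> D y -> gamma * `|x - y| ^+ 2 <= inner (x - y) (dF x - dF y).
Proof.
move=> g0 cD sc dF_ Dx Dy.
have := strongly_convex_gradient g0 cD sc (dF_ _ Dx) Dx Dy.
have := strongly_convex_gradient g0 cD sc (dF_ _ Dy) Dy Dx.
rewrite (distrC y x) !innerE (innerC x) (innerC y) (innerC x (dF y)) (innerC y); lra.
Qed.

(** Here v is the difference of two points and w that of the gradients. *)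
Lemma gradient_step_contraction (gamma L s : R) (v w : X) : 0 <= s ->
  gamma * `|v| ^+ 2 <= inner v w -> `|w| <= L * `|v| ->
  `|v - s *: w| <= Num.sqrt (1 - 2 * s * gamma + s ^+ 2 * L ^+ 2) * `|v|.
Proof.
move=> s0 mon lip.
have w2 : `|w| ^+ 2 <= L ^+ 2 * `|v| ^+ 2.
  by rewrite -exprMn lerXn2r ?nnegrE // (le_trans _ lip).
rewrite mulrC -[leLHS]ger0_norm // -sqrtr_sqr.
rewrite -[X in _ <= X * _]ger0_norm // -sqrtr_sqr -sqrtrM ?sqr_ge0 //.
apply: ler_wsqrtr; rewrite normB_sqr innerZr normrZ exprMn real_normK ?num_real //.
have : s * (gamma * `|v| ^+ 2) <= s * inner v w by rewrite ler_wpM2l.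
have : s ^+ 2 * `|w| ^+ 2 <= s ^+ 2 * (L ^+ 2 * `|v| ^+ 2).
  by rewrite ler_wpM2l ?sqr_ge0.
lra.
Qed.

End StrongConvexity.

(** * Step length arithmetic and error propagation *)

Section ConvergenceFactors.
Context {R : realType}.

(** Squaring, the claim becomes s^2 L^2 < 2 s (gamma - C) + s^2 C^2, and the
    step length bound gives this even without the last term. *)
Lemma contraction_factor_lt1 (gamma L s C : R) : 0 < s -> 0 < L ->
  s * C < 1 -> s < (gamma - C) * (2 / L ^+ 2) ->
  Num.sqrt (1 - 2 * s * gamma + s ^+ 2 * L ^+ 2) + s * C < 1.
Proof.
move=> s0 L0 sC; rewrite mulrA ltr_pdivlMr ?exprn_gt0 // -(ltr_pM2l s0) => sL.
have h : 0 < 1 - s * C by lra.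
rewrite -ltrBrDr -[ltRHS]gtr0_norm // -sqrtr_sqr ltr_sqrt ?exprn_gt0 //.
have := sqr_ge0 (s * C); lra.
Qed.

(** One step of a tracked solver. The new error a' is to be compared with the new
    distance e', of which only e' >= e - d is known, d being the length of the
    outer step; the condition on d is what remains after this loss. *)
Lemma tracking_error_step (kappa C b c e e' d a' : R) : 0 < kappa ->
  0 <= C -> e <= e' + d -> (b + kappa * C) * d <= (kappa * C - c) * e ->
  kappa * a' <= c * e + b * d -> a' <= C * e'.
Proof.
move=> k0 C0 ee bd ka; rewrite -(ler_pM2l k0) (le_trans ka) //.
have : kappa * C * e <= kappa * C * (e' + d) by rewrite ler_wpM2l ?mulr_ge0 ?(ltW k0).
lra.
Qed.

Lemma geometric_cvg0_linearly (x : nat -> R) (mu : R) : (forall n, 0 <= x n) ->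
  0 <= mu < 1 -> (forall n, x n.+1 <= mu * x n) -> cvg0_linearly x.
Proof.
move=> x0 mu01 xS; have [mu0 mu1] := andP mu01; split; last by exists mu.
have xle n : 0 <= x n <= geometric (x 0%N) mu n.
  rewrite x0 /=; elim: n => [|n IH]; first by rewrite expr0 mulr1.
  by rewrite (le_trans (xS n)) // exprS mulrCA ler_wpM2l.
apply: (@squeeze_cvgr _ _ _ _ (fun=> 0) (geometric (x 0%N) mu)).
- exact: nearW.
- exact: cvg_cst.
- by apply: cvg_geometric; rewrite ger0_norm.
Qed.

End ConvergenceFactors.

(** Split T x - T' x' as T' (x - x') + (T - T') (x - x') + (T - T') x'. Only the
    norms of T' and T - T' occur, which are the quantities under control. *)
Lemma apply_difference_bound (R : realType) (X Y : hilbertType R)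
    (Q Qih : bounded_op X X) (T : bounded_op X Y) (T' : X -> Y) x x' :
  is_inv_sqrt Q Qih -> bounded_homogeneous T' ->
  `|T x - T' x'| <=
    (Qinv_norm Qih T' + Qinv_norm Qih (T \- T')) * Qnorm Q (x - x') +
    Qinv_norm Qih (T \- T') * Qnorm Q x'.
Proof.
move=> hQ bT'.
have bD : bounded_homogeneous (T \- T').
  by apply: bounded_homogeneousB => //; exact: bounded_homogeneous_op.
have -> : T x - T' x' = T' (x - x') + (T \- T') (x - x') + (T \- T') x'.
  by rewrite /= [T' _ + _]addrC subrK linearB /= addrA subrK.
rewrite (le_trans (ler_normD _ _)) // lerD //; last exact: Qinv_norm_bound.
rewrite (le_trans (ler_normD _ _)) // mulrDl lerD //; exact: Qinv_norm_bound.
Qed.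

(** * Convergence of the algorithm *)

Theorem theorem2p12 (R : realType) (U A : hilbertType R)
  (Reg : A -> \bar R) (J : U -> R) (G : (U * A)%type -> U)
  (uhat : U) (phat : bounded_op U A) (ahat : A)
  (* solution map and its derivative, preconditioner Q and Q^(-1/2) *)
  (S : A -> U) (dS : A -> bounded_op A U) (Q Qih : bounded_op U U)
  (* inner and adjoint algorithms *)
  (Au : U -> A -> U) (Ap : U -> bounded_op U A -> A -> bounded_op U A)
  (r_a r_u L_S kappa_u pi_u kappa_p pi_p C_S L_J gamma_a L_a C_R
     C_u C_p N_J N_S sigma : R)
  (u : nat -> U) (p : nat -> bounded_op U A) (alpha : nat -> A) :
  let gradS := fun a => adjoint (dS a) in
  let ballR := fun s => closed_ball_ Num.norm ahat s `&` edom Reg in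
  let A2r := ballR (2 * r_a) in
  let ballQ := closed_ball_ (Qnorm Q) uhat r_u in
  let r := Num.min r_a (r_u / (C_u + L_S)) in
  let N_p := N_S + C_p * r_a in
  let C_a := L_J * N_p * C_u + N_J * C_p in
  let D := fun a => prox (fun z => (sigma%:E * Reg z)%E)
                         (a - sigma *: phat (gradient J uhat)) - a in
  (* setting *)
  [/\ econvex Reg, eproper Reg & lower_semicontinuous Reg] ->
  convex_function [set: convex_lmodType U] J ->
  (forall v, differentiable (J : U -> R^o) v) ->
  (forall z, differentiable G z) ->
  (* the point (uhat, phat, ahat) *)
  G (uhat, ahat) = 0 ->
  (forall v, phat (grad_u G uhat ahat v) + grad_alpha G uhat ahat v = 0) ->
  (exists2 q, subdifferential Reg ahat q & phat (gradient J uhat) + q = 0) ->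
  uhat = S ahat ->
  (forall v, phat v = gradS ahat v) ->
  (* Tracking Assumption (i) *)
  0 < r_a -> 0 < r_u -> 0 <= L_S ->
  C1_on A2r S dS ->
  (forall a, A2r a -> G (S a, a) = 0) ->
  pos_def Q -> is_inv_sqrt Q Qih ->
  (forall a1 a2, A2r a1 -> A2r a2 ->
     Qnorm Q (S a1 - S a2) <= L_S * `|a1 - a2|) ->
  (* (ii) *)
  0 < pi_u -> 1 < kappa_u ->
  (forall v a1 a2, ballQ v -> A2r a1 -> A2r a2 ->
     kappa_u * Qnorm Q (Au v a2 - S a2) <=
       Qnorm Q (v - S a1) + pi_u * `|a2 - a1|) ->
  (* (iii) *)
  0 < C_S -> 0 < pi_p -> 1 < kappa_p ->
  (forall (q : bounded_op U A) v a1 a2, ballQ v -> A2r a1 -> A2r a2 ->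
     kappa_p * Qinv_norm Qih (Ap v q a2 \- gradS a2) <=
       Qinv_norm Qih (q \- gradS a1) + C_S * Qnorm Q (v - S a2)
       + pi_p * `|a2 - a1|) ->
  (* (iv) *)
  0 <= L_J ->
  (forall v w, Qnorm Q (gradient J v - gradient J w) <= L_J * Qnorm Q (v - w)) ->
  0 < gamma_a -> 0 < L_a ->
  strongly_convex_on (ballR r) gamma_a (J \o S) ->
  lipschitz_gradient_on (ballR r) L_a (J \o S)
    (fun a => gradS a (gradient J (S a))) ->
  0 <= C_R ->
  (forall a, ballR r_a a -> `|D a - D ahat| <= sigma * C_R * `|a - ahat|) ->
  (* (v) *)
  0 < C_u -> 0 < C_p ->
  Qnorm Q (u 1%N - S (alpha 0%N)) <= C_u * `|alpha 0%N - ahat| ->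
  Qinv_norm Qih (p 1%N \- gradS (alpha 0%N)) <= C_p * `|alpha 0%N - ahat| ->
  C_S * kappa_u^-1 * C_u < (kappa_p - 1) * C_p ->
  (let E := [set Qnorm Q (gradient J (S a)) | a in ballR r_a] in
   (E `&` ubound E) N_J) ->
  (let E := [set Qinv_norm Qih (gradS a) | a in ballR r_a] in
   (E `&` ubound E) N_S) ->
  C_a < gamma_a ->
  (* (vi) *)
  closed_ball_ Num.norm ahat r (alpha 0%N) ->
  (* (vii) *)
  0 < sigma ->
  sigma <= (C_a + L_a + C_R)^-1 *
    Num.min ((kappa_u - 1) * C_u / (pi_u + kappa_u * C_u))
            (((kappa_p - 1) * C_p - C_S * kappa_u^-1 * C_u) /
             (pi_p + kappa_p * C_p + C_S * kappa_u^-1 * pi_u)) ->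
  sigma < (gamma_a - C_a) * (2 / L_a ^+ 2) ->
  (* the algorithm *)
  generated_by_algorithm Reg J sigma Au Ap A2r S gradS Q Qih
    kappa_u kappa_p pi_u pi_p C_S u p alpha ->
  cvg0_linearly (fun n => `|alpha n - ahat| ^+ 2).
Proof.
move=> gradS ballR A2r ballQ r N_p C_a D [cReg pReg lscReg] _ _ _ _ _ [q Regq Jq].
move=> uhatE phatE ra0 ru0 LS0 _ _ _ hQ _ piu0 ku1 _ CS0 pip0 kp1 _ LJ0 lipJ.
move=> gamma0 La0 scJS [dJS lipJS] CR0 DC Cu0 Cp0 init_u init_p Cup.
move=> [[a1 _ NJE] NJ] [[a2 _ NSE] NS] Cagamma alpha0_ball sigma0 sigma_le sigma_lt alg.
have [Reg0 _ trackU _ trackP outer] := alg.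
have ku0 : 0 < kappa_u by lra.
have kp0 : 0 < kappa_p by lra.
have NJ0 : 0 <= N_J by rewrite -NJE sqrtr_ge0.
have NS0 : 0 <= N_S by rewrite -NSE opnorm_ge0.
have Np0 : 0 <= N_p by rewrite addr_ge0 // mulr_ge0 // ltW.
have Ca0 : 0 <= C_a by rewrite addr_ge0 // !mulr_ge0 // ltW.
pose K := C_a + L_a + C_R.
have K0 : 0 < K by rewrite /K; lra.
pose bu := pi_u + kappa_u * C_u.
have kC : 0 < kappa_u * C_u by rewrite mulr_gt0.
have bu0 : 0 < bu by rewrite /bu; lra.
pose bp := pi_p + C_S * kappa_u^-1 * pi_u + kappa_p * C_p.
have bp0 : 0 < bp.
  by rewrite !addr_gt0 // !mulr_gt0 // invr_gt0.
have [stepU stepP] : bu * (sigma * K) <= (kappa_u - 1) * C_u /\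
    bp * (sigma * K) <= (kappa_p - 1) * C_p - C_S * kappa_u^-1 * C_u.
  move: sigma_le; rewrite -/K ler_pdivlMl // le_min.
  rewrite (addrAC pi_p) -/bu -/bp !ler_pdivlMr // => /andP[].
  by rewrite (mulrC K) ![_ * bu]mulrC ![_ * bp]mulrC.
(* kappa_u C_u < bu gives sigma K < 1 already from the state half of the bound. *)
have sCa : sigma * C_a < 1.
  have : bu * (sigma * K) < bu * 1 by rewrite mulr1 /bu; move: stepU; rewrite /bu; lra.
  rewrite ltr_pM2l // /K => sK.
  have : 0 <= sigma * L_a by rewrite mulr_ge0 // ltW.
  have : 0 <= sigma * C_R by rewrite mulr_ge0 // ltW.
  lra.
pose c := Num.sqrt (1 - 2 * sigma * gamma_a + sigma ^+ 2 * L_a ^+ 2) + sigma * C_a.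
have c0 : 0 <= c by rewrite addr_ge0 ?sqrtr_ge0 // mulr_ge0 // ltW.
have c1 : c < 1 by exact: contraction_factor_lt1.
pose g z := (sigma%:E * Reg z)%E.
have cg : econvex g by exact: econvex_scale.
have pg : eproper g by exact: eproper_scale.
have lscg : lower_semicontinuous g by exact: lower_semicontinuous_scale.
have gq : subdifferential g ahat (sigma *: q) by exact: subdifferential_scale.
have qE : q = - phat (gradient J uhat) by apply/eqP; rewrite -addr_eq0 addrC Jq.
(* The optimality condition makes ahat a fixed point of the exact step; in
   particular D ahat = 0. *)
have proxhat : prox g (ahat - sigma *: phat (gradient J uhat)) = ahat.
  by rewrite -scalerN -qE (prox_fixpoint cg pg lscg gq).
have ahat_dom : edom Reg ahat by exact: subdifferential_edom pReg Regq.
have r_ra : r <= r_a by rewrite ge_min lexx.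
have r0 : 0 <= r by exact: le_trans alpha0_ball.
have ballS s s' a : s <= s' -> ballR s a -> ballR s' a.
  by move=> ss' [/= a_s Rega]; split=> //=; exact: le_trans ss'.
have ball_ahat : ballR r ahat by split; rewrite //= /closed_ball_ /= subrr normr0.
have ballR_convex v w (t : R) : ballR r v -> ballR r w -> 0 <= t <= 1 ->
    ballR r (t *: v + (1 - t) *: w).
  by move=> [vr Rv] [wr Rw] t01; split; [exact: closed_ball_convex|exact: econvex_edom].
pose e n := `|alpha n - ahat|.
have e0 n : 0 <= e n by exact: normr_ge0.
pose tracked n := [/\ ballR r (alpha n),
  Qnorm Q (u n.+1 - S (alpha n)) <= C_u * e n &
  Qinv_norm Qih (p n.+1 \- gradS (alpha n)) <= C_p * e n].
pose gradJS a := gradS a (gradient J (S a)).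
have gradJS_hat : gradJS ahat = phat (gradient J uhat).
  by rewrite /gradJS -uhatE phatE.
have e_ra n : tracked n -> e n <= r_a.
  by move=> [[/= + _] _ _]; rewrite /closed_ball_ /= distrC => /le_trans; exact.
have grad_err n : tracked n ->
    `|p n.+1 (gradient J (u n.+1)) - gradJS (alpha n)| <= C_a * e n.
  move=> tn; have [an un pn] := tn; have an' := ballS _ _ _ r_ra an.
  have := apply_difference_bound (p n.+1) (gradient J (u n.+1))
    (gradient J (S (alpha n))) hQ (bounded_homogeneous_adjoint (dS (alpha n))).
  move=> /le_trans; apply; rewrite /C_a [leRHS]mulrDl; apply: lerD.
    rewrite [L_J * _]mulrC -!mulrA; apply: ler_pM.
    - by rewrite addr_ge0 // opnorm_ge0.
    - exact: sqrtr_ge0.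
    - rewrite lerD //; first by apply: NS; exists (alpha n).
      by rewrite (le_trans pn) // ler_pM2l // e_ra.
    - by rewrite (le_trans (lipJ _ _)) // ler_wpM2l.
  rewrite -mulrA mulrC; apply: ler_pM => //; first exact: sqrtr_ge0.
    exact: opnorm_ge0.
  by apply: NJ; exists (alpha n).
(* Compare with the proximal step z that uses the gradient at ahat: its distance
   to alpha^n is the residual D. *)
have step_le n : tracked n -> `|alpha n.+1 - alpha n| <= sigma * K * e n.
  move=> tn; have [an un pn] := tn.
  pose z := prox g (alpha n - sigma *: phat (gradient J uhat)).
  rewrite -(subrKA z) (le_trans (ler_normD _ _)) // /K mulrDr mulrDl lerD //.
    rewrite outer (le_trans (prox_nonexpansive _ _ cg pg lscg gq)) //.
    rewrite opprB addrC addrA subrK -scalerBr normrZ gtr0_norm // -mulrA.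
    rewrite ler_pM2l // -gradJS_hat distrC -(subrKA (gradJS (alpha n))).
    rewrite (le_trans (ler_normD _ _)) // mulrDl lerD ?grad_err //.
    exact: lipJS.
  have := DC _ (ballS _ _ _ r_ra an).
  by rewrite /D -/g proxhat subrr subr0.
(* Exact gradient step plus gradient error, seen through the nonexpansive prox. *)
have contract n : tracked n -> e n.+1 <= c * e n.
  move=> tn; have [an un pn] := tn.
  rewrite /e outer -[in leLHS]proxhat.
  rewrite (le_trans (prox_nonexpansive _ _ cg pg lscg gq)) //.
  rewrite (_ : _ - _ - _ = (alpha n - ahat - sigma *: (gradJS (alpha n) - gradJS ahat))
     - sigma *: (p n.+1 (gradient J (u n.+1)) - gradJS (alpha n))); last first.
    rewrite gradJS_hat -[RHS]addrA -opprD -scalerDr.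
    rewrite [_ + (_ - gradJS _)]addrC subrKA scalerBr !opprB.
    by rewrite addrACA [RHS]addrACA (addrC (- ahat)).
  rewrite (le_trans (ler_normB _ _)) // /c mulrDl lerD //.
    apply: gradient_step_contraction; first exact: ltW.
      exact: (strongly_convex_gradient_monotone (ltW gamma0) ballR_convex scJS dJS).
    exact: lipJS.
  by rewrite normrZ gtr0_norm // -mulrA ler_pM2l // grad_err.
have tracked_next n : tracked n -> tracked n.+1.
  move=> tn; have [an un pn] := tn; have dn := step_le _ tn.
  set d := `|_| in dn.
  have en1 : e n.+1 <= e n.
    by rewrite (le_trans (contract _ tn)) // ler_piMl // ltW.
  have ed : e n <= e n.+1 + d.
    rewrite /e /d (distrC (alpha n.+1) (alpha n)) [leRHS]addrC.
    by rewrite -(subrKA (alpha n.+1) (alpha n)) ler_normD.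
  have an1 : ballR r (alpha n.+1).
    split; first by rewrite /closed_ball_ /= distrC (le_trans en1) // /e distrC; case: an.
    rewrite -(edom_scale _ sigma0) outer.
    exact: subdifferential_edom pg (subdifferential_prox _ cg pg lscg gq).
  have rA : r <= 2 * r_a by lra.
  have A0 : A2r (alpha n) by exact: ballS an.
  have A1 : A2r (alpha n.+1) by exact: ballS an1.
  have tU := trackU _ A1 A0; have tP := trackP _ A1 A0; rewrite /= -/d in tU tP.
  have bud : (pi_u + kappa_u * C_u) * d <= (kappa_u * C_u - C_u) * e n.
    rewrite (@le_trans _ _ (bu * (sigma * K) * e n)) //.
      by rewrite -[leRHS]mulrA ler_pM2l.
    by rewrite ler_wpM2r //; move: stepU; lra.
  have tU' : kappa_u * Qnorm Q (u n.+2 - S (alpha n.+1)) <= C_u * e n + pi_u * d by lra.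
  split=> //; first exact: (tracking_error_step ku0 (ltW Cu0) ed bud tU').
  (* The state error just bounded enters the adjoint recursion through C_S, which
     adds to the coefficients of both e n and d. *)
  pose cp := C_p + C_S * kappa_u^-1 * C_u.
  apply: (tracking_error_step (b := pi_p + C_S * kappa_u^-1 * pi_u) (c := cp)
    kp0 (ltW Cp0) ed).
    rewrite (@le_trans _ _ (bp * (sigma * K) * e n)) //.
      by rewrite -[leRHS]mulrA ler_pM2l.
    by rewrite ler_wpM2r // /cp; move: stepP; lra.
  have : C_S * Qnorm Q (u n.+2 - S (alpha n.+1)) <=
      C_S * (kappa_u^-1 * (C_u * e n + pi_u * d)).
    by rewrite ler_pM2l // mulrC ler_pdivlMr // mulrC.
  by rewrite /cp; lra.
have all_tracked n : tracked n.
  by elim: n => [|n]; [split|exact: tracked_next].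
apply: (@geometric_cvg0_linearly _ _ (c ^+ 2)).
- by move=> n; rewrite exprn_ge0.
- by rewrite sqr_ge0 expr_lt1.
- move=> n; rewrite -exprMn lerXn2r ?nnegrE ?mulr_ge0 //.
  exact: contract.
Qed.
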